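(* Let $T,T'$ be contractions on a complex Hilbert space $\mathcal{H}$ such that $T$ is Harnack dominated by $T'$. Then $\sigma(T)\cap\mathbb{T}=\sigma(T')\cap\mathbb{T}$ and $\sigma_p(T)\cap\mathbb{T}=\sigma_p(T')\cap\mathbb{T}$. In particular, $\sigma(T)\subset\mathbb{D}$ if and only if $\sigma(T')\subset\mathbb{D}$.
   Context: $\mathbb{D}$ is the open unit disc and $\mathbb{T}$ the unit circle in $\mathbb{C}$; $\sigma(T)$ and $\sigma_p(T)$ denote the spectrum and the point spectrum of $T$. A contraction on $\mathcal{H}$ is a bounded linear operator of norm at most $1$. For contractions $T,T'$ on $\mathcal{H}$, $T$ is Harnack dominated by $T'$ if there is a constant $c\ge 1$ such that $\operatorname{Re} p(T)\le c\,\operatorname{Re} p(T')$ for every analytic polynomial $p$ with $\operatorname{Re} p(z)\ge 0$ for all $|z|\le 1$; here $\operatorname{Re} A=\frac12(A+A^* )$ for an operator $A$. *)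

(* Defs.v *)
From HB Require Import structures.
From mathcomp Require Import all_boot all_order all_algebra.
From mathcomp Require Import complex.
From mathcomp Require Import boolp classical_sets reals topology normedtype.

Set Implicit Arguments.
Unset Strict Implicit.
Unset Printing Implicit Defensive.
Import Order.TTheory GRing.Theory Num.Theory.
Import numFieldNormedType.Exports.
Local Open Scope classical_set_scope.
Local Open Scope complex_scope.
Local Open Scope ring_scope.

(* A complex Hilbert space is a complete normed module [H] over [R[i]] together
   with an inner product [dot : {dot H for Num.conj}] (linear in the first
   argument, conjugate-linear in the second) such that [norm_of_dot dot]. *)
Definition norm_of_dot (R : realType) (H : completeNormedModType R[i])
    (dot : {dot H for Num.conj}) : Prop :=
  forall x : H, `|x| ^+ 2 = dot x x.

Definition unit_disc (R : realType) : set R[i] := [set z | `|z| < 1].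

Definition unit_circle (R : realType) : set R[i] := [set z | `|z| = 1].

Section Operators.
Context (R : realType) (H : completeNormedModType R[i]).

(* The norms of [H] take values in [R[i]], hence the injections [M%:C]. *)
Definition op_bound (A : H -> H) (M : R) : Prop :=
  0 <= M /\ forall x, `|A x| <= M%:C * `|x|.

Definition bounded_op (A : H -> H) : Prop := exists M, op_bound A M.

(* Meaningful for bounded operators only: [inf] of the empty set is [0]. *)
Definition op_norm (A : H -> H) : R := inf [set M | op_bound A M].

Definition contraction_op (T : {linear H -> H}) : Prop :=
  bounded_op T /\ op_norm T <= 1.

Definition spectrum (T : {linear H -> H}) : set R[i] :=
  [set lam | ~ exists S : {linear H -> H},
     [/\ bounded_op S,
         forall x, S (T x - lam *: x) = x
       & forall x, T (S x) - lam *: S x = x]].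

Definition point_spectrum (T : {linear H -> H}) : set R[i] :=
  [set lam | exists2 x : H, x != 0 & T x = lam *: x].

Definition poly_op (p : {poly R[i]}) (T : H -> H) : H -> H :=
  fun x => \sum_(i < size p) p`_i *: iter i T x.

Context (dot : {dot H for Num.conj}).

(* The choice is determined: for a bounded linear [A], the vector [z] exists by
   the Riesz representation theorem, and it is unique. *)
Definition adjoint (A : H -> H) : H -> H :=
  fun y => xget 0 [set z | forall x, dot (A x) y = dot x z].

Definition op_Re (A : H -> H) : H -> H :=
  fun x => 2^-1 *: (A x + adjoint A x).

(* In [R[i]], [0 <= w] means that [w] is real and nonnegative. *)
Definition op_le (A B : H -> H) : Prop :=
  forall x, 0 <= dot (B x - A x) x.

Definition harnack_dominated (T T' : {linear H -> H}) : Prop :=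
  exists c : R, 1 <= c /\
    forall p : {poly R[i]},
      (forall z : R[i], `|z| <= 1 -> 0 <= complex.Re p.[z]) ->
      op_le (op_Re (poly_op p T))
            (fun x => c%:C *: op_Re (poly_op p T') x).

End Operators.

(* Main.v *)
Require Import Defs.
From HB Require Import structures.
From mathcomp Require Import all_boot all_order all_algebra.
From mathcomp Require Import complex.
From mathcomp Require Import boolp classical_sets reals topology normedtype.
From mathcomp Require Import ring lra.

Import Order.TTheory GRing.Theory Num.Theory.
Import numFieldNormedType.Exports.
Local Open Scope classical_set_scope.
Local Open Scope complex_scope.
Local Open Scope ring_scope.

Set Implicit Arguments.
Unset Strict Implicit.
Unset Printing Implicit Defensive.

(** Everything takes place at a point lam of the unit circle, where the
contraction W := lam^-1 T replaces T and the question is whether 1 - W is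
injective, respectively invertible. For a contraction, |x - W x|^2 <= 2 Re <x - W x, x>, so a vector
orthogonal to the range of 1 - W is fixed by W; hence 1 - W has dense range as
soon as it is injective, and is invertible as soon as it is bounded below
([contraction_range_dense], [contraction_bounded_below_surj]).

Harnack domination Re p(T) <= c Re p(T') is tested on two polynomials, both of
nonnegative real part on the closed disc. Let W' := lam^-1 T'.

- p(z) = 1 - z / lam vanishes at lam. Combined with the inequality above it
  gives |T x - lam x|^2 <= 2 c |T' x - lam x| |x| ([harnack_defect_le]), so
  that (approximate) eigenvectors of T' at lam are (approximate) eigenvectors
  of T: this is the passage from T' to T.

- For the passage from T to T' one needs polynomials that are large at lam: the
  analytic completions p_n of the Fejer kernels, normalized by
  p_n(lam) = n^2. If x is almost fixed by W, then <p_n(W) x, x> is about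
  n^2 |x|^2 ([fejer_sum_ge]). On the other side the geometric sums in p_n
  telescope on the range of 1 - W': if x = (u - W' u) + v, then |p_n(W') x| is
  at most n (4 |u| + 2 n |v| + |x|) ([fejer_sum_le]). Comparing the two
  ([harnack_fejer_le]) for large n rules out that x is in the range of 1 - W'
  with a controlled preimage u (take v = 0), and even that x is in the closure
  of that range (take v small). The first case settles the spectra, the second
  one the point spectra.

The nonnegativity of Re p_n on the disc comes from the stronger inequality
Re p_n >= |1 + w + ... + w^(n-1)|^2 at w = z / lam, which goes through by
induction on n ([fejer_kernel_ge0]).

To use the operator inequality one must know that the chosen adjoints are
adjoints, hence the Riesz representation theorem. It follows from the same
minimization argument as the density statement above
([orthogonal_approximation]). The last claim of the theorem follows from the
first, because the spectrum of a contraction lies in the closed disc. *)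

(** * The real-valued norm *)

Section HilbertSpace.
Context (R : realType) (H : completeNormedModType R[i]).
Implicit Types (x y z : H) (r : R).

(** The norm of [H] has values in [R[i]]; its real-valued version is the one that
real inequalities can use. *)
Definition hnorm x : R := complex.Re `|x|.

Lemma hnormE x : `|x| = (hnorm x)%:C.
Proof. by rewrite /hnorm RRe_real // normr_real. Qed.

Lemma hnorm_ge0 x : 0 <= hnorm x.
Proof. by rewrite -ler0c -hnormE. Qed.

Lemma hnorm0 : hnorm 0 = 0.
Proof. by rewrite /hnorm normr0. Qed.

Lemma hnorm0_eq0 x : hnorm x = 0 -> x = 0.
Proof. by move=> h; apply/normr0_eq0; rewrite hnormE h. Qed.

Lemma hnorm_small_eq0 x K : (forall e, 0 < e -> hnorm x <= K * e) -> x = 0.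
Proof.
move=> h; apply/hnorm0_eq0/eqP; rewrite eq_le hnorm_ge0 andbT.
apply/ler_addgt0Pr => e e0; rewrite add0r.
have K1 : 0 < `|K| + 1 by rewrite ltr_wpDl.
apply: le_trans (h (e / (`|K| + 1)) _) _; first exact: divr_gt0.
rewrite mulrCA -[leRHS]mulr1 ler_pM2l // ler_pdivrMr // mul1r.
by rewrite (le_trans (ler_norm K)) // lerDl.
Qed.

Lemma hnormN x : hnorm (- x) = hnorm x.
Proof. by rewrite /hnorm normrN. Qed.

Lemma hnormB x y : hnorm (x - y) = hnorm (y - x).
Proof. by rewrite -hnormN opprB. Qed.

Lemma hnormD_le x y : hnorm (x + y) <= hnorm x + hnorm y.
Proof. by rewrite -lecR rmorphD /= -!hnormE ler_normD. Qed.

Lemma hnormMn x n : hnorm (x *+ n) = hnorm x *+ n.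
Proof. by apply: (@complexI R); rewrite rmorphMn /= -!hnormE normrMn. Qed.

Lemma hnormZ (a : R[i]) x : hnorm (a *: x) = complex.Re `|a| * hnorm x.
Proof.
by rewrite {1}/hnorm normrZ hnormE; case: (`|a|) => p q /=; rewrite mulr0 subr0.
Qed.

Lemma hnorm_sum_le (I : Type) (s : seq I) (P : pred I) (F : I -> H) :
  hnorm (\sum_(i <- s | P i) F i) <= \sum_(i <- s | P i) hnorm (F i).
Proof.
elim/big_ind2 : _ => //; first by rewrite hnorm0.
by move=> x1 r1 x2 r2 h1 h2; rewrite (le_trans (hnormD_le _ _)) // lerD.
Qed.

Lemma invn_le (e : R) : 0 < e ->
  exists N, forall n, (N <= n)%N -> n.+1%:R^-1 <= e.
Proof.
move=> e0; exists (Num.truncn e^-1) => n Nn.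
rewrite invf_ple ?posrE //; apply/ltW/(lt_le_trans (truncnS_gt _)).
by rewrite ler_nat ltnS.
Qed.

Lemma hnorm_complete (u : nat -> H) :
  (forall e, 0 < e ->
     exists N, forall m n, (N <= m)%N -> (N <= n)%N -> hnorm (u m - u n) <= e) ->
  exists l, forall e, 0 < e ->
     exists N, forall n, (N <= n)%N -> hnorm (u n - l) <= e.
Proof.
move=> hu.
have /cauchy_cvg : cauchy (u @ \oo).
  apply: cauchy_exP => e e0.
  have re : e = (complex.Re e)%:C by rewrite RRe_real // gtr0_real.
  have re0 : 0 < complex.Re e by rewrite -ltcR -re.
  have [|N hN] := hu (complex.Re e / 2); first by rewrite divr_gt0.
  exists (u N); exists N => // n /= Nn.
  rewrite -ball_normE /= hnormE re ltcR.
  apply: le_lt_trans (hN _ _ (leqnn _) Nn) _.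
  by rewrite ltr_pdivrMr // ltr_pMr // ltr1n.
move=> /cvg_ex[l /cvgrPdist_le ul]; exists l => e e0.
have [|N _ hN] := ul e%:C; first by rewrite ltcR.
by exists N => n Nn; rewrite hnormB -lecR -hnormE; apply: hN.
Qed.

(** * The real inner product *)

Section InnerProduct.
Context (dot : {dot H for Num.conj}) (hdot : norm_of_dot dot).

Definition rdot x y : R := complex.Re (dot x y).

Lemma dotC x y : dot x y = (dot y x)^*.
Proof. by rewrite hermC /= expr0 mul1r. Qed.

Lemma rdotC x y : rdot x y = rdot y x.
Proof. by rewrite /rdot dotC; case: (dot y x). Qed.

Lemma rdotDl x1 x2 y : rdot (x1 + x2) y = rdot x1 y + rdot x2 y.
Proof. by rewrite /rdot linearDl raddfD. Qed.

Lemma rdotNl x y : rdot (- x) y = - rdot x y.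
Proof. by rewrite /rdot linearNl raddfN. Qed.

Lemma rdotBl x1 x2 y : rdot (x1 - x2) y = rdot x1 y - rdot x2 y.
Proof. by rewrite rdotDl rdotNl. Qed.

Lemma rdotZl r x y : rdot (r%:C *: x) y = r * rdot x y.
Proof.
by rewrite /rdot linearZl_LR /=; case: (dot x y) => a b /=; rewrite mul0r subr0.
Qed.

Lemma hnorm_sqr x : hnorm x ^+ 2 = rdot x x.
Proof.
apply: (@complexI R); rewrite rmorphXn /= -hnormE hdot /rdot RRe_real //.
by rewrite -hdot rpredX // normr_real.
Qed.

Lemma hnorm_sqrD x y :
  hnorm (x + y) ^+ 2 = hnorm x ^+ 2 + rdot x y *+ 2 + hnorm y ^+ 2.
Proof.
rewrite !hnorm_sqr rdotDl ![rdot _ (x + y)]rdotC !rdotDl (rdotC y x); ring.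
Qed.

(** Cauchy-Schwarz is read off from the triangle inequality, which is part of the
structure of [H]. *)
Lemma rdot_le x y : rdot x y <= hnorm x * hnorm y.
Proof.
have h : hnorm (x + y) ^+ 2 <= (hnorm x + hnorm y) ^+ 2.
  by rewrite ler_sqr ?nnegrE ?addr_ge0 ?hnorm_ge0 ?hnormD_le.
move: h; rewrite hnorm_sqrD; lra.
Qed.

Lemma rdot_norm_le x y : `|rdot x y| <= hnorm x * hnorm y.
Proof. by rewrite ler_norml rdot_le andbT lerNl -rdotNl -(hnormN x) rdot_le. Qed.

(** * Orthogonality, representation of functionals, adjoints *)

(** The orthogonal projection theorem for a subspace [M] that need not be closed:
[z] is the component of [x] orthogonal to the closure of [M]. The vectors [x - m]
of almost minimal norm form a Cauchy sequence by the parallelogram identity, and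
its limit is orthogonal to [M] because moving it along [M] cannot decrease its
norm. *)
Lemma orthogonal_approximation (M : H -> Prop) (M0 : M 0)
    (ML : forall (a : R[i]) m m', M m -> M m' -> M (a *: m + m')) x :
  exists z, (forall m, M m -> dot z m = 0) /\
    forall e, 0 < e -> exists2 m, M m & hnorm (x - m - z) <= e.
Proof.
have MD m m' : M m -> M m' -> M (m + m') by rewrite -{2}(scale1r m); apply: ML.
have MZ a m : M m -> M (a *: m) by move=> Mm; rewrite -[_ *: _]addr0; apply: ML.
pose D := [set r | exists2 m, M m & r = hnorm (x - m) ^+ 2].
have lbD : lbound D 0 by move=> _ [m _ ->]; rewrite sqr_ge0.
have Dd m : M m -> inf D <= hnorm (x - m) ^+ 2.
  by move=> Mm; apply: ge_inf; [exists 0 | exists m].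
have infD : has_inf D by split; [exists (hnorm (x - 0) ^+ 2), 0 | exists 0].
have /choice[u hu] n : exists m, M m /\ hnorm (x - m) ^+ 2 < inf D + n.+1%:R^-1.
  have [|_ [m Mm ->] h] := @inf_adherent _ D n.+1%:R^-1 _ infD.
    by rewrite invr_gt0.
  by exists m.
pose h : R := 2^-1.
have half : h%:C + h%:C = 1 :> R[i].
  rewrite -rmorphD -[in RHS](rmorph1 (real_complex R)); congr (_%:C).
  by rewrite /h; lra.
have u_dist n k : hnorm (u n - u k) ^+ 2 <= (n.+1%:R^-1 + k.+1%:R^-1) *+ 2.
  have [Mn hn] := hu n; have [Mk hk] := hu k.
  have : M (h%:C *: u n + h%:C *: u k) by apply/MD; apply/MZ.
  move=> /Dd.
  have -> : x - (h%:C *: u n + h%:C *: u k) =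
      h%:C *: (x - u n) + h%:C *: (x - u k).
    by rewrite !scalerBr addrACA -scalerDl half scale1r opprD.
  have -> : u n - u k = (x - u k) - (x - u n).
    by rewrite opprB [RHS]addrC addrA subrK.
  move: hn hk; move: (x - u n) (x - u k) => y z.
  rewrite !hnorm_sqrD !hnorm_sqr !rdotZl ![rdot _ (h%:C *: _)]rdotC !rdotZl.
  rewrite [rdot _ (- _)]rdotC !rdotNl [rdot _ (- _)]rdotC rdotNl (rdotC y z) /h.
  move: (inf D) n.+1%:R^-1 k.+1%:R^-1 => d a b; lra.
have [|l ul] := hnorm_complete (u := u).
  move=> e e0; have [|N hN] := @invn_le (e ^+ 2 / 4).
    by rewrite divr_gt0 ?exprn_gt0.
  exists N => n k /hN hn /hN hk.
  rewrite -ler_sqr ?nnegrE ?hnorm_ge0 ?(ltW e0) //.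
  apply: le_trans (u_dist n k) _.
  move: n.+1%:R^-1 k.+1%:R^-1 hn hk => a b; lra.
exists (x - l); split; last first.
  move=> e /ul[N /(_ _ (leqnn _)) hN]; exists (u N); first by have [] := hu N.
  by rewrite opprB addrC addrA subrK hnormB.
have re_orth m : M m -> rdot (x - l) m = 0.
  move=> Mm; set a := rdot _ m; set q := hnorm m ^+ 2.
  have q0 : 0 <= q by rewrite sqr_ge0.
  (* In the limit, |z|^2 <= |z + t m|^2 for z = x - l and every real t. *)
  have key t : 0 <= t * a *+ 2 + t ^+ 2 * q.
    apply/ler_addgt0Pr => e e0.
    have K0 : 0 < `|t| * hnorm m *+ 2 + 1.
      by rewrite ltr_wpDl // mulrn_wge0 // mulr_ge0 ?hnorm_ge0.
    pose d := e / (`|t| * hnorm m *+ 2 + 1).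
    have d0 : 0 < d by rewrite divr_gt0.
    have [N1 h1] := invn_le d0; have [N2 h2] := ul _ d0.
    pose n := maxn N1 N2.
    have {}h1 := h1 n (leq_maxl _ _); have {}h2 := h2 n (leq_maxr _ _).
    have [Mn hn] := hu n.
    have : M (u n + (- t)%:C *: m) by apply/MD => //; apply/MZ.
    move=> /Dd; rewrite opprD addrA -scaleNr -rmorphN opprK hnorm_sqrD.
    rewrite [rdot _ (_ *: _)]rdotC rdotZl rdotC => hd.
    have := rdot_norm_le (l - u n) m; rewrite ler_norml => /andP[b1 b2].
    have b3 : rdot (x - u n) m = a + rdot (l - u n) m.
      by rewrite -rdotDl addrA subrK.
    have : hnorm (t%:C *: m) ^+ 2 = t ^+ 2 * q.
      by rewrite hnorm_sqr rdotZl rdotC rdotZl mulrA -expr2 -hnorm_sqr.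
    move: hd; rewrite b3 => hd hq; rewrite hq in hd.
    have : t * rdot (l - u n) m <= `|t| * (d * hnorm m).
      apply: le_trans (ler_norm _) _; rewrite normrM ler_wpM2l //.
      apply: le_trans (rdot_norm_le _ _) _.
      by rewrite ler_wpM2r ?hnorm_ge0 // hnormB.
    have : d * (`|t| * hnorm m *+ 2 + 1) = e by rewrite mulfVK // gt_eqF.
    move: n.+1%:R^-1 (inf D) h1 hn hd => n1 D1 h1 hn hd; lra.
  have q1 : 0 < q + 1 by rewrite ltr_wpDl.
  (* The minimum in t is at -a/q; the denominator q + 1 also covers q = 0. *)
  have := key (- a / (q + 1)).
  have -> : - a / (q + 1) * a *+ 2 + (- a / (q + 1)) ^+ 2 * q =
      - (a ^+ 2 * (q + 2)) / (q + 1) ^+ 2 by field; rewrite gt_eqF.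
  rewrite mulNr oppr_ge0 pmulr_lle0 ?invr_gt0 ?exprn_gt0 // => aq.
  apply/eqP; rewrite -sqrf_eq0 eq_le sqr_ge0 andbT.
  by move: aq; rewrite pmulr_lle0 // ltr_wpDl.
(* Orthogonality to both m and i m makes the real and imaginary parts vanish. *)
move=> m Mm; have := re_orth _ Mm; have := re_orth _ (MZ 'i _ Mm).
rewrite /rdot linearZr_LR /=; case: (dot (x - l) m) => a b /=.
by rewrite mul0r sub0r mulN1r opprK => -> ->.
Qed.

(** The representing vector is proportional to the component, orthogonal to the
kernel of [f], of a vector where [f] is 1. A bound on the real part of [f] is a
bound on [f], since [f] is complex linear. *)
Lemma riesz (f : H -> R[i]) (K : R)
    (fL : forall a x y, f (a *: x + y) = a * f x + f y)
    (fK : forall x, complex.Re (f x) <= K * hnorm x) :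
  exists z, forall x, f x = dot x z.
Proof.
have f0 : f 0 = 0 by have := fL (-1) 0 0; rewrite scaler0 addr0 mulN1r addNr.
have fZ a x : f (a *: x) = a * f x by rewrite -[a *: x]addr0 fL f0 addr0.
have fB x y : f (x - y) = f x - f y by rewrite addrC -scaleN1r fL mulN1r addrC.
have [fx0|/existsNP[x1 /eqP fx1]] := pselect (forall x, f x = 0).
  by exists 0 => x; rewrite fx0 linear0r.
pose x0 := (f x1)^-1 *: x1.
have fx0 : f x0 = 1 by rewrite fZ mulVf.
have [||z [zker zx]] := @orthogonal_approximation (fun x => f x = 0) _ _ x0.
- by [].
- by move=> a m m' fm fm'; rewrite fL fm fm' mulr0 addr0.
(* The bound fK carries f x0 = 1 over to z, a limit of vectors x0 - m with
   f m = 0. *)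
have fz : f z = 1.
  apply/esym/eqP; rewrite -subr_eq0; set w := _ - _; apply/eqP.
  suff : complex.Re (w^* * w) <= 0.
    case: w => p q /=; rewrite mulNr opprK => h.
    have /eqP : p * p + q * q = 0.
      by apply/eqP; rewrite eq_le h addr_ge0 // -expr2 sqr_ge0.
    rewrite paddr_eq0 ?mulf_eq0 ?orbb -?expr2 ?sqr_ge0 //.
    by case/andP => /eqP-> /eqP->.
  apply/ler_addgt0Pr => e e0; rewrite add0r.
  pose L := K * complex.Re `|w^*|.
  have L1 : 0 < `|L| + 1 by rewrite ltr_wpDl.
  have [|m fm hm] := zx (e / (`|L| + 1)); first exact: divr_gt0.
  have -> : w^* * w = f (w^* *: (x0 - m - z)) by rewrite fZ !fB fm subr0 fx0.
  apply: le_trans (fK _) _; rewrite hnormZ mulrA -/L.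
  apply: le_trans (ler_wpM2r (hnorm_ge0 _) (ler_norm L)) _.
  apply: le_trans (ler_wpM2l (normr_ge0 L) hm) _.
  by rewrite mulrCA -[leRHS]mulr1 ler_pM2l // ler_pdivrMr // mul1r lerDl.
have zz : dot z z != 0.
  rewrite dnorm_eq0; apply/eqP => z0; move/eqP: fz.
  by rewrite z0 f0 eq_sym oner_eq0.
exists ((dot z z)^-1 *: z) => y.
have : dot z (y - f y *: z) = 0 by apply: zker; rewrite fB fZ fz mulr1 subrr.
rewrite linearBr linearZr_LR /= => /eqP; rewrite subr_eq0 => /eqP h.
rewrite linearZr_LR /= [dot y z]dotC h rmorphM /= fmorphV /= -!dotC.
by rewrite conjCK mulrCA mulVf ?mulr1.
Qed.

Lemma adjointE (A : H -> H) (AL : forall a x y, A (a *: x + y) = a *: A x + A y)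
    (Ab : bounded_op A) x y : dot (A x) y = dot x (adjoint dot A y).
Proof.
have [M [M0 hM]] := Ab.
have [||z hz] := @riesz (fun x => dot (A x) y) (M * hnorm y).
- by move=> a u v; rewrite AL linearPl.
- move=> u; rewrite mulrAC; apply: le_trans (rdot_le _ _) _.
  by rewrite ler_wpM2r ?hnorm_ge0 // -lecR rmorphM /= -!hnormE.
rewrite /adjoint; case: xgetP => [w -> hw|/(_ z)/(_ hz)//]; exact: hw.
Qed.

Lemma rdot_op_Re (A : H -> H)
    (AL : forall a x y, A (a *: x + y) = a *: A x + A y)
    (Ab : bounded_op A) x : rdot (op_Re dot A x) x = rdot (A x) x.
Proof.
have -> : op_Re dot A x = (2^-1 : R)%:C *: (A x + adjoint dot A x).
  by rewrite fmorphV rmorph_nat.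
have adj : rdot x (adjoint dot A x) = rdot (A x) x by rewrite /rdot -adjointE.
rewrite rdotZl rdotDl (rdotC (adjoint _ _ _)) adj; lra.
Qed.

(** * Contractions and their spectrum *)

(** The operator norm is an infimum, so only the bounds [1 + e] are available
before passing to the limit. *)
Lemma contraction_le (T : {linear H -> H}) x :
  contraction_op T -> hnorm (T x) <= hnorm x.
Proof.
move=> [[M0 hM0] T1]; apply/ler_addgt0Pr => e e0.
have x1 : 0 < hnorm x + 1 by rewrite ltr_wpDl // hnorm_ge0.
have infT : has_inf [set M | op_bound T M].
  by split; [exists M0 | exists 0 => M []].
have d0 : 0 < e / (hnorm x + 1) by apply: divr_gt0.
have [M [_ hM] Mlt] := inf_adherent d0 infT.
have : hnorm (T x) <= M * hnorm x by rewrite -lecR rmorphM /= -!hnormE.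
move/le_trans; apply.
have M1 : M <= 1 + e / (hnorm x + 1).
  by apply/ltW/(lt_le_trans Mlt); rewrite lerD2r.
apply: le_trans (ler_wpM2r (hnorm_ge0 x) M1) _.
rewrite mulrDl mul1r lerD2l -mulrA -[leRHS]mulr1 ler_pM2l // mulrC.
by rewrite ler_pdivrMr // mul1r lerDl.
Qed.

Section Contraction.
Context (W : {linear H -> H}) (Wc : forall x, hnorm (W x) <= hnorm x).

(** Since [|W x| <= |x|], the equality [Re <W x, x> = |x|^2] is the case of equality
in Cauchy-Schwarz and forces [W x = x]; this is the quantitative form. *)
Lemma contraction_defect x : hnorm (x - W x) ^+ 2 <= rdot (x - W x) x *+ 2.
Proof.
have : hnorm (W x) ^+ 2 <= hnorm x ^+ 2 by rewrite ler_sqr ?nnegrE ?hnorm_ge0.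
rewrite hnorm_sqrD hnormN rdotBl rdotC rdotNl -hnorm_sqr; lra.
Qed.

Lemma defectB x y : (x - y) - W (x - y) = (x - W x) - (y - W y).
Proof. by rewrite linearB !opprD addrACA. Qed.

Lemma defect_le x : hnorm (x - W x) <= hnorm x *+ 2.
Proof. by rewrite (le_trans (hnormD_le _ _)) // hnormN mulr2n lerD2l. Qed.

(** A vector [z] orthogonal to the range of [1 - W] is in particular orthogonal to
[z - W z], so it is fixed by [contraction_defect]. *)
Lemma contraction_range_dense (ker0 : forall z, W z = z -> z = 0) x e :
  0 < e -> exists u, hnorm (x - (u - W u)) <= e.
Proof.
have [||z [hz zx]] := @orthogonal_approximation
    (fun m => exists u, m = u - W u) _ _ x.
- by exists 0; rewrite linear0 subrr.
- move=> a _ _ [u ->] [v ->]; exists (a *: u + v).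
  by rewrite linearP scalerBr opprD addrACA.
have z0 : z = 0.
  apply/ker0/esym/subr0_eq/hnorm0_eq0/eqP.
  rewrite -sqrf_eq0 eq_le sqr_ge0 andbT.
  apply: le_trans (contraction_defect z) _.
  by rewrite rdotC /rdot hz ?mul0rn //; exists z.
by move=> /zx[_ [u ->]]; rewrite z0 subr0; exists u.
Qed.

(** The range of [1 - W] is dense, and closed because [1 - W] is bounded below on
a complete space. *)
Lemma contraction_bounded_below_surj M
    (hM : forall x, hnorm x <= M * hnorm (x - W x)) y :
  exists u, u - W u = y.
Proof.
have [|u hu] := @choice _ _ (fun n u => hnorm (y - (u - W u)) <= n.+1%:R^-1) _.
  move=> n; apply: contraction_range_dense; last by rewrite invr_gt0.
  by move=> z Wz; apply: (@hnorm_small_eq0 _ 0) => e _; rewrite mul0r;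
     have := hM z; rewrite Wz subrr hnorm0 mulr0.
have M1 : 0 < `|M| + 1 by rewrite ltr_wpDl.
have hM1 x : hnorm x <= (`|M| + 1) * hnorm (x - W x).
  apply: le_trans (hM x) _; rewrite ler_wpM2r ?hnorm_ge0 //.
  by rewrite (le_trans (ler_norm M)) // lerDl.
have [|l ul] := hnorm_complete (u := u).
  move=> e e0; have [|N hN] := @invn_le (e / (`|M| + 1) / 2).
    by rewrite !divr_gt0.
  exists N => m n /hN hm /hN hn.
  apply: le_trans (hM1 _) _; rewrite mulrC -ler_pdivlMr // defectB.
  have -> : u m - W (u m) - (u n - W (u n)) =
      (y - (u n - W (u n))) - (y - (u m - W (u m))).
    by rewrite [RHS]addrC [- (y - _)]opprB addrA subrK.
  apply: le_trans (hnormD_le _ _) _; rewrite hnormN.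
  apply: le_trans (lerD (hu n) (hu m)) _.
  by apply: le_trans (lerD hn hm) _; rewrite -splitr.
exists l; apply/subr0_eq/(@hnorm_small_eq0 _ 3) => e e0.
have [N1 h1] := invn_le e0; have [N2 h2] := ul _ e0.
pose n := maxn N1 N2.
have {}h1 := h1 n (leq_maxl _ _); have {}h2 := h2 n (leq_maxr _ _).
have -> : l - W l - y = ((l - u n) - W (l - u n)) - (y - (u n - W (u n))).
  by rewrite defectB [- (y - _)]opprB addrA subrK.
apply: le_trans (hnormD_le _ _) _; rewrite hnormN.
have := defect_le (l - u n); rewrite hnormB in h2.
move: n.+1%:R^-1 h1 (hu n) => a h1 hun; lra.
Qed.

End Contraction.

(** Outside the open disc the spectrum of a contraction is approximate point
spectrum: the rescaled operator is still a contraction, to which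
[contraction_bounded_below_surj] applies. *)
Lemma bounded_below_notin_spectrum (T : {linear H -> H}) (hT : contraction_op T)
    (lam : R[i]) (lam1 : 1 <= `|lam|) M
    (hM : forall x, hnorm x <= M * hnorm (T x - lam *: x)) :
  ~ spectrum T lam.
Proof.
have lam0 : lam != 0 by rewrite -normr_gt0 (lt_le_trans ltr01).
pose W : {linear H -> H} := (lam^-1 \*: T).
have WE x : x - W x = - (lam^-1 *: (T x - lam *: x)).
  by rewrite scalerBr scalerA mulVf // scale1r opprB.
have Wc x : hnorm (W x) <= hnorm x.
  apply: le_trans (contraction_le x hT).
  rewrite -lecR -!hnormE /= normrZ ler_piMl // normfV invf_le1 //.
  by rewrite (lt_le_trans ltr01).
have hMW x : hnorm x <= M * complex.Re `|lam| * hnorm (x - W x).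
  apply: le_trans (hM x) _; rewrite -mulrA -hnormZ WE scalerN hnormN.
  by rewrite scalerA mulfV // scale1r.
have surj y : exists u, T u - lam *: u = y.
  have [u hu] := contraction_bounded_below_surj Wc hMW (- (lam^-1 *: y)).
  exists u; apply/(scalerI (a := lam^-1)); first by rewrite invr_eq0.
  by apply/oppr_inj; rewrite -WE.
have inj x : T x - lam *: x = 0 -> x = 0.
  move=> h; apply: (@hnorm_small_eq0 _ 0) => e _; rewrite mul0r.
  by have := hM x; rewrite h hnorm0 mulr0.
have [S hS] := choice surj.
have inj2 x y : T x - lam *: x = T y - lam *: y -> x = y.
  move=> h; apply/subr0_eq/inj; rewrite linearB scalerBr /= !opprD addrACA.
  by rewrite -opprD h subrr.
have SK x : S (T x - lam *: x) = x by apply/inj2; rewrite hS.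
have SL : linear S.
  move=> a x y; apply/inj2; rewrite hS linearP scalerDr opprD addrACA hS.
  by rewrite scalerA mulrC -scalerA -scalerBr hS.
pose SlM := GRing.isLinear.Build _ _ _ _ S SL.
pose Sl : {linear H -> H} := HB.pack S SlM.
apply; exists Sl; split => //.
exists `|M|; split => // x.
rewrite !hnormE -rmorphM lecR; apply: le_trans (hM (S x)) _.
by rewrite hS ler_wpM2r ?hnorm_ge0 // ler_norm.
Qed.

(** * Fejer sums of iterates *)

Section FejerMeans.
Context (W : {linear H -> H}) (Wc : forall x, hnorm (W x) <= hnorm x).

Definition geom_sum (V : H -> H) n x := \sum_(k < n) iter k V x.

(** Up to the factor [1 / n] this is the analytic completion of the Fejer kernel:
the real part of [fejer_sum] at a complex number of modulus 1 is
[|geom_sum|^2]. *)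
Definition fejer_sum (V : H -> H) n x :=
  \sum_(j < n) (geom_sum V j.+1 x *+ 2 - x).

Lemma iter_linearP k a x y :
  iter k W (a *: x + y) = a *: iter k W x + iter k W y.
Proof. by elim: k => //= k ->; rewrite linearP. Qed.

Lemma iter_linearB k x y : iter k W (x - y) = iter k W x - iter k W y.
Proof. by elim: k => //= k ->; rewrite linearB. Qed.

Lemma iter_contraction_le k x : hnorm (iter k W x) <= hnorm x.
Proof. by elim: k => //= k IH; rewrite (le_trans (Wc _)). Qed.

Lemma geom_sumD n x y : geom_sum W n (x + y) = geom_sum W n x + geom_sum W n y.
Proof.
rewrite -big_split; apply: eq_bigr => k _.
by rewrite -[x]scale1r iter_linearP !scale1r.
Qed.

Lemma geom_sum_defect n u : geom_sum W n (u - W u) = u - iter n W u.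
Proof.
rewrite /geom_sum; elim: n => [|n IH]; first by rewrite big_ord0 subrr.
by rewrite big_ord_recr /= IH iter_linearB -iterSr addrA subrK.
Qed.

Lemma geom_sum_le n x : hnorm (geom_sum W n x) <= hnorm x *+ n.
Proof.
apply: le_trans (hnorm_sum_le _ _ _) _.
apply: (@le_trans _ _ (\sum_(k < n) hnorm x)); last first.
  by rewrite sumr_const card_ord.
by apply: ler_sum => k _; apply: iter_contraction_le.
Qed.

(** On the range of [1 - W] the geometric sums telescope and stay bounded, so that
the part [u - W u] contributes only linearly in [n]; the quadratic growth is
paid by [v] alone. *)
Lemma fejer_sum_le n x u v : x = (u - W u) + v ->
  hnorm (fejer_sum W n x) <= n%:R * (4 * hnorm u + 2 * n%:R * hnorm v + hnorm x).
Proof.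
move=> xE; apply: le_trans (hnorm_sum_le _ _ _) _.
set r := 4 * _ + _ + _.
apply: (@le_trans _ _ (\sum_(j < n) r)); last first.
  by rewrite sumr_const card_ord mulr_natl.
apply: ler_sum => j _.
apply: le_trans (hnormD_le _ _) _; rewrite hnormN lerD2r hnormMn.
have : hnorm (geom_sum W j.+1 x) <= 2 * hnorm u + n%:R * hnorm v; last by lra.
rewrite {1}xE geom_sumD geom_sum_defect.
apply: le_trans (hnormD_le _ _) _; apply: lerD.
  apply: le_trans (hnormD_le _ _) _; rewrite hnormN.
  by have := iter_contraction_le j.+1 u; lra.
apply: le_trans (geom_sum_le _ _) _; rewrite -[_ *+ j.+1]mulr_natl.
by rewrite ler_wpM2r ?hnorm_ge0 // ler_nat.
Qed.

Lemma iter_displacement_le k x : hnorm (x - iter k W x) <= hnorm (x - W x) *+ k.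
Proof.
rewrite -geom_sum_defect; exact: geom_sum_le.
Qed.

Lemma geom_sum_displacement_le n m x : (m <= n)%N ->
  hnorm (x *+ m - geom_sum W m x) <= n%:R ^+ 2 * hnorm (x - W x).
Proof.
move=> mn.
have -> : x *+ m - geom_sum W m x = \sum_(k < m) (x - iter k W x).
  by rewrite sumrB sumr_const card_ord.
apply: le_trans (hnorm_sum_le _ _ _) _.
apply: (@le_trans _ _ (\sum_(k < m) n%:R * hnorm (x - W x))).
  apply: ler_sum => k _; apply: le_trans (iter_displacement_le _ _) _.
  rewrite -[_ *+ k]mulr_natl ler_wpM2r ?hnorm_ge0 // ler_nat.
  by rewrite (leq_trans (ltnW (ltn_ord k))).
rewrite sumr_const card_ord -[_ *+ m]mulr_natl mulrA ler_wpM2r ?hnorm_ge0 //.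
by rewrite expr2 ler_wpM2r // ler_nat.
Qed.

Lemma rdot_sumMl (I : Type) (s : seq I) (P : pred I) (F : I -> H) y :
  rdot (\sum_(i <- s | P i) F i) y = \sum_(i <- s | P i) rdot (F i) y.
Proof.
elim/big_ind2 : _ => [|x1 r1 x2 r2 <- <-|//]; first by rewrite /rdot linear0l.
exact: rdotDl.
Qed.

(** On a fixed vector, [fejer_sum W n] is multiplication by [n ^ 2], the sum of the
first [n] odd numbers; the error term measures how far [x] is from fixed. *)
Lemma fejer_sum_ge n x :
  n%:R ^+ 2 * hnorm x ^+ 2 - 2 * n%:R ^+ 3 * hnorm (x - W x) * hnorm x
  <= rdot (fejer_sum W n x) x.
Proof.
set d := hnorm (x - W x).
have sum_odd : \sum_(j < n) (2 * j%:R + 1) = n%:R ^+ 2 :> R.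
  elim: (n) => [|m IH]; first by rewrite big_ord0 expr0n.
  by rewrite big_ord_recr /= IH -natr1; ring.
rewrite rdot_sumMl.
have -> : n%:R ^+ 2 * hnorm x ^+ 2 - 2 * n%:R ^+ 3 * d * hnorm x =
  \sum_(j < n) ((2 * j%:R + 1) * hnorm x ^+ 2 - 2 * n%:R ^+ 2 * d * hnorm x).
  by rewrite sumrB -mulr_suml sum_odd sumr_const card_ord -[_ *+ n]mulr_natl; ring.
apply: ler_sum => j _.
have := rdot_le (x *+ j.+1 - geom_sum W j.+1 x) x.
have := geom_sum_displacement_le x (ltn_ord j); rewrite -/d => h1 h2.
have : rdot (x *+ j.+1) x = (j%:R + 1) * hnorm x ^+ 2.
  rewrite -[x *+ _]scaler_nat -(rmorph_nat (real_complex R)) rdotZl.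
  by rewrite -hnorm_sqr natr1.
have := ler_wpM2r (hnorm_ge0 x) h1.
move: h2; rewrite !rdotBl mulr2n rdotDl -(hnorm_sqr x); lra.
Qed.

End FejerMeans.

(** * Polynomials of an operator *)

Section PolynomialCalculus.
Context (T : {linear H -> H}).
Implicit Types (p q : {poly R[i]}).

Lemma poly_opE n p x : (size p <= n)%N ->
  poly_op p T x = \sum_(i < n) p`_i *: iter i T x.
Proof.
move=> pn; rewrite /poly_op (big_ord_widen n (fun i => p`_i *: iter i T x) pn).
rewrite big_mkcond; apply: eq_bigr => i _; case: ltnP => // pi.
by rewrite nth_default // scale0r.
Qed.

Lemma poly_opD p q x : poly_op (p + q) T x = poly_op p T x + poly_op q T x.
Proof.
pose n := maxn (size p) (size q).
rewrite (@poly_opE n) ?(leq_trans (size_polyD _ _)) //.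
rewrite (@poly_opE n p) ?leq_maxl // (@poly_opE n q) ?leq_maxr // -big_split.
by apply: eq_bigr => i _; rewrite coefD scalerDl.
Qed.

Lemma poly_op_monomial (a : R[i]) k x :
  poly_op (a *: 'X^k) T x = a *: iter k T x.
Proof.
rewrite (@poly_opE k.+1) ?(leq_trans (size_scale_leq _ _)) ?size_polyXn //.
rewrite big_ord_recr big1 /= => [|i _].
  by rewrite add0r coefZ coefXn eqxx mulr1.
by rewrite coefZ coefXn ltn_eqF // mulr0 scale0r.
Qed.

Lemma poly_op_sum (I : Type) (s : seq I) (F : I -> {poly R[i]}) x :
  poly_op (\sum_(i <- s) F i) T x = \sum_(i <- s) poly_op (F i) T x.
Proof.
elim: s => [|i s IH]; last by rewrite !big_cons poly_opD IH.
by rewrite !big_nil /poly_op size_poly0 big_ord0.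
Qed.

Lemma poly_op_linearP p a x y :
  poly_op p T (a *: x + y) = a *: poly_op p T x + poly_op p T y.
Proof.
rewrite /poly_op scaler_sumr -big_split; apply: eq_bigr => i _.
by rewrite iter_linearP scalerDr !scalerA mulrC.
Qed.

Lemma poly_op_bounded p : contraction_op T -> bounded_op (poly_op p T).
Proof.
move=> hT; exists (\sum_(i < size p) complex.Re `|p`_i|); split.
  by apply: sumr_ge0 => i _; rewrite -ler0c RRe_real ?normr_real.
move=> x; rewrite !hnormE -rmorphM lecR.
apply: le_trans (hnorm_sum_le _ _ _) _; rewrite mulr_suml.
apply: ler_sum => i _; rewrite hnormZ ler_wpM2l //.
  by rewrite -ler0c RRe_real ?normr_real.
by apply: iter_contraction_le => z; apply: contraction_le.
Qed.

Lemma iter_scale (a : R[i]) k x : iter k (a \*: T) x = a ^+ k *: iter k T x.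
Proof.
elim: k => [|k IH]; first by rewrite scale1r.
by rewrite /= IH /= linearZ_LR scalerA -exprS.
Qed.

End PolynomialCalculus.

(** * Test polynomials *)

Definition geom_poly (a : R[i]) n : {poly R[i]} := \sum_(k < n) a ^+ k *: 'X^k.

(** The constant is written as a multiple of ['X^0] so that [poly_op_monomial]
computes every summand. *)
Definition fejer_poly (a : R[i]) n : {poly R[i]} :=
  \sum_(j < n) (geom_poly a j.+1 *+ 2 + (-1) *: 'X^0).

Lemma poly_op_fejer (T : {linear H -> H}) a n x :
  poly_op (fejer_poly a n) T x = fejer_sum (a \*: T) n x.
Proof.
rewrite poly_op_sum; apply: eq_bigr => j _.
rewrite mulr2n !poly_opD poly_op_monomial scaleN1r -mulr2n.
congr (_ *+ 2 - _).
rewrite poly_op_sum; apply: eq_bigr => k _.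
by rewrite poly_op_monomial iter_scale.
Qed.

(** With [g n = \sum_(k < n) w ^+ k], the real part of the sum is at least
[|g n|^2]. The induction step is [|g (n+1) - 1|^2 = |w|^2 |g n|^2 <= |g n|^2],
that is [|g (n+1)|^2 <= |g n|^2 + 2 Re g (n+1) - 1]. *)
Lemma fejer_kernel_ge0 (w : R[i]) n : `|w| <= 1 ->
  0 <= complex.Re (\sum_(j < n) ((\sum_(k < j.+1) w ^+ k) *+ 2 - 1)).
Proof.
move=> w1; pose g m := \sum_(k < m) w ^+ k.
have gS m : g m.+1 = 1 + w * g m.
  rewrite /g big_ord_recl mulr_sumr; congr (_ + _).
  by apply: eq_bigr => i _; rewrite -exprS.
have w2 : complex.Re w ^+ 2 + complex.Im w ^+ 2 <= 1.
  rewrite -lecR add_Re2_Im2 rmorph1; exact: exprn_ile1.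
suff : complex.Re (g n) ^+ 2 + complex.Im (g n) ^+ 2 <=
    complex.Re (\sum_(j < n) (g j.+1 *+ 2 - 1)).
  by apply: le_trans; rewrite addr_ge0 ?sqr_ge0.
elim: n => [|n IH]; first by rewrite /g !big_ord0 /= expr0n addr0.
rewrite big_ord_recr /= raddfD /=.
apply: le_trans (lerD IH (lexx _)).
rewrite gS; case: (g n) (w) w2 => p q [r s] /=.
have := sqr_ge0 p; have := sqr_ge0 q; move=> q0 p0 rs.
have : 0 <= (1 - (r ^+ 2 + s ^+ 2)) * (p ^+ 2 + q ^+ 2).
  by rewrite mulr_ge0 ?subr_ge0 ?addr_ge0.
lra.
Qed.

Lemma fejer_poly_Re_ge0 (a : R[i]) n (z : R[i]) : `|a| <= 1 -> `|z| <= 1 ->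
  0 <= complex.Re (fejer_poly a n).[z].
Proof.
move=> a1 z1.
suff -> : (fejer_poly a n).[z] =
    \sum_(j < n) ((\sum_(k < j.+1) (a * z) ^+ k) *+ 2 - 1).
  by apply: fejer_kernel_ge0; rewrite normrM mulr_ile1.
rewrite horner_sum; apply: eq_bigr => j _.
rewrite hornerD hornerMn hornerZ hornerXn mulN1r; congr (_ *+ 2 - _).
by rewrite horner_sum; apply: eq_bigr => k _; rewrite hornerZ hornerXn exprMn.
Qed.

(** * Spectra on the unit circle *)

Lemma dist_scaled (T : {linear H -> H}) (lam : R[i]) x : `|lam| = 1 ->
  hnorm (x - (lam^-1 \*: T) x) = hnorm (T x - lam *: x).
Proof.
move=> l1; have l0 : lam != 0 by rewrite -normr_gt0 l1.
have -> : T x - lam *: x = - (lam *: (x - (lam^-1 \*: T) x)).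
  by rewrite /= scalerBr scalerA mulfV // scale1r opprB.
by rewrite hnormN hnormZ l1 /= mul1r.
Qed.

Lemma scaled_contraction (T : {linear H -> H}) (lam : R[i]) : contraction_op T ->
  `|lam| = 1 -> forall x, hnorm ((lam^-1 \*: T) x) <= hnorm x.
Proof.
move=> hT l1 x; rewrite hnormZ normfV l1 invr1 /= mul1r; exact: contraction_le.
Qed.

(** The resolvent in the form of estimates: [T - lam] is bounded below, and it has
preimages of controlled norm. *)
Lemma notin_spectrum_solve (T : {linear H -> H}) (lam : R[i]) : ~ spectrum T lam ->
  exists2 K, 0 <= K &
    (forall x, hnorm x <= K * hnorm (T x - lam *: x)) /\
    forall y, exists2 u, T u - lam *: u = y & hnorm u <= K * hnorm y.
Proof.
move=> /contrapT[S [[K [K0 hK]] SK KS]].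
have hK' y : hnorm (S y) <= K * hnorm y by rewrite -lecR rmorphM /= -!hnormE.
exists K => //; split=> [x|y]; first by rewrite -{1}(SK x).
by exists (S y).
Qed.

(** For [|lam| > 1] the operator [T - lam] is bounded below by [|lam| - 1], so that
only the circle can obstruct the inclusion. *)
Lemma spectrum_subset_disc (T : {linear H -> H}) : contraction_op T ->
  spectrum T `<=` @unit_disc R <-> spectrum T `&` @unit_circle R = set0.
Proof.
move=> hT; split=> [sT|sT lam slam].
  apply/seteqP; split=> // lam [/sT].
  by rewrite /unit_disc /unit_circle /= => + l1; rewrite l1 ltxx.
rewrite /unit_disc /=.
have lE : `|lam| = (complex.Re `|lam|)%:C by rewrite RRe_real // normr_real.
rewrite lE ltcR ltNge; apply/negP; rewrite le_eqVlt => /orP[/eqP l1|l1].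
  suff : (spectrum T `&` @unit_circle R) lam by rewrite sT.
  by split=> //; rewrite /unit_circle /= lE -l1.
apply: (@bounded_below_notin_spectrum T hT lam _ (complex.Re `|lam| - 1)^-1) slam.
  by rewrite lE lecR ltW.
move=> x; rewrite ler_pdivlMl ?subr_gt0 // mulrBl mul1r lerBlDr -hnormZ.
apply: le_trans (lerD (lexx _) (contraction_le x hT)).
by rewrite hnormB -[X in hnorm X <= _](subrK (T x)) hnormD_le.
Qed.

(** * Transfer by Harnack domination *)

Section HarnackDomination.
Context (T T' : {linear H -> H}).
Context (hT : contraction_op T) (hT' : contraction_op T').
Context (hTT' : harnack_dominated dot T T').

Lemma harnack_dominated_rdot : exists2 c : R, 0 <= c &
  forall p : {poly R[i]},
    (forall z : R[i], `|z| <= 1 -> 0 <= complex.Re p.[z]) ->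
    forall x, rdot (poly_op p T x) x <= c * rdot (poly_op p T' x) x.
Proof.
have [c [c1 hc]] := hTT'.
exists c; first by rewrite (le_trans ler01).
move=> p /hc/(_ _) hp x; have := hp x.
rewrite lecE => /andP[_]; rewrite -/(rdot _ x) rdotBl rdotZl.
rewrite !rdot_op_Re ?subr_ge0 //;
  by [exact: poly_op_linearP | exact: poly_op_bounded].
Qed.

Context (lam : R[i]) (lam1 : `|lam| = 1).
Let W : {linear H -> H} := lam^-1 \*: T.
Let W' : {linear H -> H} := lam^-1 \*: T'.

(** Domination tested on [1 - z / lam]. *)
Lemma harnack_defect_le : exists2 c, 0 <= c & forall x,
  hnorm (T x - lam *: x) ^+ 2 <= 2 * c * hnorm (T' x - lam *: x) * hnorm x.
Proof.
have [c c0 hc] := harnack_dominated_rdot; exists c => // x.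
pose p : {poly R[i]} := 1 *: 'X^0 + (- lam^-1) *: 'X^1.
have pE (V : {linear H -> H}) : poly_op p V x = x - (lam^-1 \*: V) x.
  by rewrite poly_opD !poly_op_monomial scale1r scaleNr.
have p0 (z : R[i]) : `|z| <= 1 -> 0 <= complex.Re p.[z].
  move=> z1; rewrite hornerD !hornerZ !hornerXn mul1r mulNr raddfB /= subr_ge0.
  rewrite -lecR; apply: le_trans (_ : `|lam^-1 * z| <= _); last first.
    by rewrite normrM normfV lam1 invr1 mul1r.
  by apply: le_trans (normc_ge_Re _); rewrite lecR ler_norm.
have := hc p p0 x; rewrite !pE => h.
rewrite -!(dist_scaled _ _ lam1).
apply: le_trans (contraction_defect (scaled_contraction hT lam1) x) _.
have := ler_wpM2l c0 (rdot_le (x - W' x) x); rewrite -/W -/W' in h *; lra.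
Qed.

(** Domination tested on the Fejer polynomials, [fejer_sum_ge] bounding the side of
[T] from below and [fejer_sum_le] that of [T'] from above; a common factor
[n |x|] is divided out. *)
Lemma harnack_fejer_le : exists2 c, 0 <= c & forall n x u v,
  x = (u - W' u) + v ->
  n%:R * hnorm x <= 2 * n%:R ^+ 2 * hnorm (T x - lam *: x) +
     c * (4 * hnorm u + 2 * n%:R * hnorm v + hnorm x).
Proof.
have [c c0 hc] := harnack_dominated_rdot; exists c => // n x u v xE.
have l1 : `|lam^-1| <= 1 by rewrite normfV lam1 invr1.
have := hc (fejer_poly lam^-1 n) (fun z : R[i] => fejer_poly_Re_ge0 n l1) x.
rewrite !poly_op_fejer -/W -/W' => h.
have h1 := fejer_sum_ge (scaled_contraction hT lam1) n x.
have h2 := fejer_sum_le (scaled_contraction hT' lam1) n xE.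
rewrite dist_scaled // -/W in h1; rewrite -/W' in h2.
set d := hnorm (T x - _) in h1 *; set B := 4 * _ + _ + _ in h2 *.
have [->|n0] := posnP n.
  rewrite mul0r expr0n mulr0 mul0r add0r mulr_ge0 //.
  by rewrite !addr_ge0 ?mulr_ge0 ?hnorm_ge0.
have [x0|x0] := eqVneq (hnorm x) 0.
  by rewrite x0 mulr0 !(addr_ge0, mulr_ge0) ?hnorm_ge0 ?exprn_ge0.
have {}x0 : 0 < hnorm x by rewrite lt_neqAle eq_sym x0 hnorm_ge0.
have {}n0 : 0 < n%:R :> R by rewrite ltr0n.
rewrite -(ler_pM2r (mulr_gt0 n0 x0)).
have := ler_wpM2l c0 (rdot_le (fejer_sum W' n x) x).
have := ler_wpM2l c0 (ler_wpM2r (hnorm_ge0 x) h2).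
lra.
Qed.

Lemma harnack_spectrum_le : spectrum T' lam -> spectrum T lam.
Proof.
move=> sT'; apply: contrapT => /notin_spectrum_solve[K K0 [hK _]].
have [c c0 hc] := harnack_defect_le.
apply: (@bounded_below_notin_spectrum T' hT' lam _ (2 * c * K ^+ 2)) sT'.
  by rewrite lam1.
move=> x; have [x0|x0] := eqVneq (hnorm x) 0.
  by rewrite x0 !mulr_ge0 ?hnorm_ge0 ?exprn_ge0.
have {}x0 : 0 < hnorm x by rewrite lt_neqAle eq_sym x0 hnorm_ge0.
rewrite -(ler_pM2r x0) -expr2.
apply: (@le_trans _ _ ((K * hnorm (T x - lam *: x)) ^+ 2)).
  by rewrite ler_sqr ?nnegrE ?mulr_ge0 ?hnorm_ge0.
rewrite exprMn; have := ler_wpM2l (sqr_ge0 K) (hc x); lra.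
Qed.

(** With [u] the preimage of [x] under [1 - W'], of norm at most [K |x|], the
estimate reads [n |x| <= 2 n^2 |T x - lam x| + c (4 K + 1) |x|]. *)
Lemma harnack_spectrum_ge : spectrum T lam -> spectrum T' lam.
Proof.
move=> sT; apply: contrapT => /notin_spectrum_solve[K K0 [_ hK]].
have [c c0 hc] := harnack_fejer_le.
have l0 : lam != 0 by rewrite -normr_gt0 lam1.
(* This n absorbs the last term and leaves at least |x| on the left. *)
pose n := (Num.truncn (c * (4 * K + 1))).+2.
have hn : c * (4 * K + 1) + 1 <= n%:R.
  by rewrite -[n%:R]natr1 lerD2r ltW // truncnS_gt.
apply: (@bounded_below_notin_spectrum T hT lam _ (2 * n%:R ^+ 2)) sT.
  by rewrite lam1.
move=> x; have [u hu uK] := hK (- (lam *: x)).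
have := hc n x u 0; rewrite addr0 hnorm0 => /(_ _).
have -> : u - W' u = x.
  apply: (scalerI l0).
  by rewrite scalerBr scalerA mulfV // scale1r -opprB hu opprK.
move=> /(_ erefl) h.
have := ler_wpM2r (hnorm_ge0 x) hn.
rewrite hnormN hnormZ lam1 mul1r in uK.
have := ler_wpM2l c0 uK; lra.
Qed.

Lemma harnack_point_spectrum_le : point_spectrum T' lam -> point_spectrum T lam.
Proof.
move=> [x x0 Tx]; exists x => //; apply/subr0_eq/hnorm0_eq0/eqP.
have [c c0 hc] := harnack_defect_le; have := hc x.
rewrite Tx subrr hnorm0 mulr0 mul0r => h.
by rewrite -sqrf_eq0 eq_le h sqr_ge0.
Qed.

(** Without an eigenvector of [T'], an eigenvector [x] of [T] is within any [e] of
the range of [1 - W']. Dividing the estimate by [n] and letting [n] grow gives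
[|x| <= 2 c e]. *)
Lemma harnack_point_spectrum_ge : point_spectrum T lam -> point_spectrum T' lam.
Proof.
move=> [x x0 Tx]; apply: contrapT => noeig; move/eqP: x0; apply.
have [c c0 hc] := harnack_fejer_le.
have l0 : lam != 0 by rewrite -normr_gt0 lam1.
have ker0 z : W' z = z -> z = 0.
  move=> Wz; apply/eqP/negP => /negP z0; apply: noeig; exists z => //.
  by rewrite -{2}Wz /W' /= scalerA mulfV // scale1r.
apply: (@hnorm_small_eq0 _ (2 * c)) => e e0.
have [u hu] := contraction_range_dense (scaled_contraction hT' lam1) ker0 x e0.
rewrite leNgt; apply/negP => lt.
pose C := c * (4 * hnorm u + hnorm x).
(* If |x| > 2 c e, the estimate n (|x| - 2 c e) <= C fails for this n. *)
pose n := (Num.truncn (C / (hnorm x - 2 * c * e))).+1.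
have : C < n%:R * (hnorm x - 2 * c * e).
  by rewrite -ltr_pdivrMr ?subr_gt0 // truncnS_gt.
have := hc n x u (x - (u - W' u)); rewrite addrC subrK => /(_ erefl).
rewrite Tx subrr hnorm0 mulr0 add0r /C.
have : c * n%:R * hnorm (x - (u - W' u)) <= c * n%:R * e.
  by rewrite ler_wpM2l ?mulr_ge0.
lra.
Qed.

End HarnackDomination.
End InnerProduct.
End HilbertSpace.

Theorem theorem4p6 (R : realType) (H : completeNormedModType R[i])
    (dot : {dot H for Num.conj}) (hdot : norm_of_dot dot)
    (T T' : {linear H -> H})
    (hT : contraction_op T) (hT' : contraction_op T')
    (hTT' : harnack_dominated dot T T') :
  [/\ spectrum T `&` @unit_circle R = spectrum T' `&` @unit_circle R,
      point_spectrum T `&` @unit_circle R =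
        point_spectrum T' `&` @unit_circle R
    & spectrum T `<=` @unit_disc R <-> spectrum T' `<=` @unit_disc R].
Proof.
have sE : spectrum T `&` @unit_circle R = spectrum T' `&` @unit_circle R.
  apply/seteqP; split=> lam [s l1]; split=> //.
    exact: (harnack_spectrum_ge hdot hT hT' hTT').
  exact: (harnack_spectrum_le hdot hT hT' hTT').
split=> //.
  apply/seteqP; split=> lam [s l1]; split=> //.
    exact: (harnack_point_spectrum_ge hdot hT hT' hTT').
  exact: (harnack_point_spectrum_le hdot hT hT' hTT').
by rewrite (spectrum_subset_disc hdot hT) (spectrum_subset_disc hdot hT') sE.
Qed.
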